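(* Let $X$ be a nonempty compact connected metric space of diameter $\le 1$ and let $\Omega:(0,\infty)\to(0,\infty)$ be a strictly increasing function such that $(0,1]\subseteq \Omega[(0,\infty)]$. If $$s:=\sum_{n=1}^\infty S_X(2^{-n})\sum_{m=n}^\infty S_X(2^{-m})\cdot\Omega^{-1}(\min\{1,2^{6-m}\})<\infty,$$ then there exists a continuous surjective function $f:[0,s]\to X$ with $\omega_f(\delta)\le\Omega(\delta)$ for all $\delta\in(0,\infty)$.
   Context: For a metric space $X$ and $\varepsilon>0$, $S_X(\varepsilon)$ denotes the smallest cardinality of a cover of $X$ by connected subsets of diameter $\le\varepsilon$ (with $S_X(\varepsilon)=\infty$ if there is no finite such cover; thus $s<\infty$ in particular requires the values $S_X(2^{-n})$, $n\ge 1$, to be finite). $\Omega[(0,\infty)]$ denotes the image of $\Omega$, and $\Omega^{-1}$ is the inverse of the injective function $\Omega$, defined on its image. For a function $f:X\to Y$ between metric spaces, its continuity modulus is $\omega_f:(0,\infty)\to[0,\infty]$, $\omega_f(\delta)=\sup(\{d_Y(f(x),f(x')):x,x'\in X,\ d_X(x,x')\le\delta\}\cup\{0\})$. The interval $[0,s]$ carries the usual Euclidean metric. *)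

(* Defs.v *)
From mathcomp Require Import all_boot all_order all_algebra.
From mathcomp Require Import all_classical all_reals all_analysis.

Set Implicit Arguments.
Unset Strict Implicit.
Unset Printing Implicit Defensive.

Import Order.TTheory GRing.Theory Num.Theory.
Import numFieldNormedType.Exports.

Local Open Scope classical_set_scope.
Local Open Scope ring_scope.

(* 0 is adjoined in [diam] and [modulus] because [ereal_sup set0 = -oo]. *)
Definition diam (R : realType) (X : metricType R) (A : set X) : \bar R :=
  ereal_sup ([set (mdist x y)%:E | x in A & y in A] `|` [set 0%E]).

Definition conn_cover (R : realType) (X : metricType R) (e : R)
    (C : set (set X)) : Prop :=
  (forall A, C A -> connected A /\ (diam A <= e%:E)%E) /\
  \bigcup_(A in C) A = [set: X].

(* The infimum is over a set of naturals, hence is attained when that set is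
   nonempty; [ereal_inf set0 = +oo] is the value in the absence of a finite
   cover. *)
Definition Snum (R : realType) (X : metricType R) (e : R) : \bar R :=
  ereal_inf [set (n%:R)%:E | n in
    [set n : nat | exists2 C : set (set X), conn_cover e C & (C #= `I_n)%card]].

(* The continuity modulus of the restriction of [f] to the subspace [A]. *)
Definition modulus (R : realType) (X Y : metricType R) (A : set X)
    (f : X -> Y) (d : R) : \bar R :=
  ereal_sup ([set r | exists x y,
    [/\ A x, A y, mdist x y <= d & r = (mdist (f x) (f y))%:E]]
    `|` [set 0%E]).

(* Main.v *)
(* For every m cover X by S_m = S_X(2^-m) closed connected sets of diameter at
   most 2^-m.  Recursively choose walks W_m (consecutive sets intersect) through
   all sets of the m-th cover: replace each set B of W_m by a walk through all
   sets of the next cover that meet B, which is possible as B is connected, and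
   erase the loops between successive first visits.  So W_{m+1} has length at
   most S_{m+1}^2, and each of its members has a parent in W_m which it meets,
   in an order-preserving way.

   Let a_m = Omega^-1(min(1, 2^(6-m))) and let the i-th member of W_N start at
   time sum_{k<=N} a_k i_k, where i_k is the position of its level-k ancestor.
   Members whose starting times differ by less than a_k have the same level-k
   ancestor, so they are 3*2^-k-close, and all times are at most
   sum_k S_k^2 a_k, which is at most s: only the first term m = n of every inner
   sum is needed.  The limit along an ultrafilter of these step functions from
   [0,s] to X is onto and moves points at distance < a_k by at most 3*2^-k,
   whence the bound by Omega. *)
Require Import Defs.
From mathcomp Require Import all_boot all_order all_algebra.
From mathcomp Require Import all_classical all_reals all_analysis.
From mathcomp Require Import lra.

Set Implicit Arguments.
Unset Strict Implicit.
Unset Printing Implicit Defensive.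

Import Order.TTheory GRing.Theory Num.Theory.
Import numFieldNormedType.Exports.

Local Open Scope classical_set_scope.
Local Open Scope ring_scope.

(** * Walks on keyed vertices: erasing loops and visiting prescribed vertices *)

Section Walks.
Local Open Scope nat_scope.

Lemma path_relpre_eq (T K : Type) (h : T -> K) (e : rel K) x y p :
  h x = h y -> path (relpre h e) x p = path (relpre h e) y p.
Proof. by case: p => //= z p ->. Qed.

(** Induct on the walk: if the key [h x] recurs in the already erased tail, drop everything up to
    that recurrence; otherwise keep the tail. Elements of [T] may carry data beyond their key, and
    the order of these data survives because [q] is a subsequence of [p]. *)
Lemma loop_erasure (T K : eqType) (h : T -> K) (e : rel K) x p :
  path (relpre h e) x p ->
  exists q, [/\ subseq q p, path (relpre h e) x q, h (last x q) = h (last x p)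
    & uniq (map h (x :: q))].
Proof.
elim: p x => [|y p IHp] x; first by exists [::].
rewrite [path _ _ _]/= => /andP[exy /IHp[q [qp pathq lastq uniqq]]].
case: (boolP (h x \in map h (y :: q))) => [|xnotin]; last first.
  exists (y :: q); split => //.
  - by rewrite /= eqxx.
  - by rewrite /= exy.
  - by rewrite map_cons cons_uniq xnotin.
case/mapP=> z zin hz.
have yqp : subseq (y :: q) (y :: p) by rewrite /= eqxx.
have pathyq : path (relpre h e) x (y :: q) by rewrite /= exy.
have lastyq : h (last x (y :: q)) = h (last x (y :: p)) by [].
move: (y :: q) zin yqp pathyq uniqq lastyq => s.
case/splitPr=> s1 s2 sp; rewrite cat_path [path _ (last _ _) _]/= => /and3P[_ _ ps2].
rewrite map_cat cat_uniq => /and3P[_ _]; rewrite last_cat [last _ (_ :: _)]/= => us ls.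
exists s2; split.
- apply: subseq_trans sp; apply: (subseq_trans (subseq_cons _ z)).
  exact: suffix_subseq.
- by rewrite (path_relpre_eq _ _ hz).
- by rewrite -ls; case: (s2).
- by rewrite map_cons hz.
Qed.

(* Loops are erased only between successive first visits to elements of [Z]. *)
Lemma thin_walk (T K : eqType) (h : T -> K) (e : rel K) (V Z : seq K) x p :
  path (relpre h e) x p -> {subset map h (x :: p) <= V} ->
  {subset Z <= map h p} ->
  exists q, [/\ subseq q p, path (relpre h e) x q,
    {subset Z <= map h (x :: q)} & size q <= size Z * size V].
Proof.
move: {2}(size Z) (leqnn (size Z)) => k.
elim: k => [|k IHk] in Z x p *.
  by case: Z => // _ _ _ _; exists [::]; split; rewrite ?sub0seq.
case: Z => [_ _ _ _|z0 Z']; first by exists [::]; split; rewrite ?sub0seq.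
set Z := z0 :: Z' => sZ pathp pV Zp.
have hasp : has (fun y => h y \in Z) p.
  have /mapP[y yp hy] := Zp z0 (mem_head _ _).
  by apply/hasP; exists y => //; rewrite -hy mem_head.
(* [z] is the first element of [p] whose key lies in [Z]. Loops are erased up to [z]; the remaining
   keys of [Z] do not occur in [p1], so the recursion from [z] finds them in [p2]. *)
have [z [p1 [p2 [pE hz p1Z]]]] : exists z p1 p2,
    [/\ p = rcons p1 z ++ p2, h z \in Z & ~~ has (fun y => h y \in Z) p1].
  by case: (split_find hasp) => z p1 p2 hz p1Z; exists z, p1, p2.
move: pathp pV Zp; rewrite {}pE {hasp}.
rewrite -cats1 -catA cat1s cat_path /= => /and3P[pp1 ez pp2] pV Zp.
have pathz : path (relpre h e) x (rcons p1 z) by rewrite rcons_path pp1.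
have [q1 [q1p pathq1 lastq1 uniqq1]] := loop_erasure pathz.
rewrite last_rcons in lastq1.
pose Z1 := [seq w <- Z | w != h z].
have sZ1 : size Z1 < size Z.
  rewrite size_filter -(count_predC (pred1 (h z)) Z) -[X in X < _]add0n ltn_add2r.
  by rewrite -has_count has_pred1.
have Z1p : {subset Z1 <= map h p2}.
  move=> w; rewrite mem_filter => /andP[/= wz wZ].
  have := Zp w wZ; rewrite map_cat mem_cat => /orP[/mapP[y yp1 wy]|].
    by case/hasP: p1Z; exists y => //; rewrite -wy.
  by rewrite /= inE (negPf wz).
have [|w wp2|q2 [q2p pathq2 Zq2 sq2]] := IHk Z1 z p2 _ pp2 _ Z1p.
- by rewrite -ltnS; apply: leq_trans sZ1 _.
- apply: pV; move: wp2; rewrite !(map_cons, map_cat, inE, mem_cat) => /orP[] ->.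
    by rewrite !orbT.
  by rewrite !orbT.
exists (q1 ++ q2); split.
- by rewrite -cat_rcons; exact: cat_subseq.
- by rewrite cat_path pathq1 (path_relpre_eq _ _ lastq1).
- move=> w wZ; have [->|wz] := eqVneq w (h z).
    by rewrite -lastq1 -map_cons; apply: map_f; rewrite -cat_cons mem_cat mem_last.
  have := Zq2 w; rewrite mem_filter /= wz wZ => /(_ isT).
  rewrite !(map_cons, map_cat, inE, mem_cat) => /orP[/eqP ->|->]; last by rewrite !orbT.
  rewrite -lastq1 orbA; apply/orP; left.
  by have := mem_last x q1; rewrite inE => /orP[/eqP ->|/(map_f h) ->]; rewrite ?eqxx ?orbT.
- rewrite size_cat; apply: (@leq_trans ((size Z1).+1 * size V)); last first.
    by rewrite leq_mul2r sZ1 orbT.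
  rewrite mulSn leq_add //.
  (* The erased piece together with its start has distinct keys in [V], so each recursive step adds
     fewer than [size V] elements. *)
  have : size (map h (x :: q1)) <= size V.
    apply: uniq_leq_size => // w; rewrite map_cons inE => wq1; apply: pV.
    rewrite inE; case/orP: wq1 => [->//|/mapP[y /(mem_subseq q1p) yp ->]].
    by rewrite -cat_rcons map_cat mem_cat map_f ?orbT.
  by rewrite size_map => /ltnW.
Qed.

Definition walk_connected (T : eqType) (P : pred T) (e : rel T) :=
  forall i j, P i -> P j -> exists p, [/\ path e i p, all P p & last i p = j].

Lemma visiting_walk (T : eqType) (P : pred T) (e : rel T) (Z : seq T) i j :
  walk_connected P e -> all P Z -> P i -> P j ->
  exists p, [/\ path e i p, all P p, last i p = j & {subset Z <= i :: p}].
Proof.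
move=> conP; elim: Z i => [|z Z IHZ] i.
  by move=> _ Pi Pj; have [p [? ? ?]] := conP i j Pi Pj; exists p.
move=> /= /andP[Pz PZ] Pi Pj.
have [p1 [pathp1 allp1 lastp1]] := conP i z Pi Pz.
have [p2 [pathp2 allp2 lastp2 Zp2]] := IHZ z PZ Pz Pj.
exists (p1 ++ p2); split.
- by rewrite cat_path pathp1 lastp1.
- by rewrite all_cat allp1.
- by rewrite last_cat lastp1.
- have zin : z \in i :: (p1 ++ p2).
    by rewrite -cat_cons mem_cat -{1}lastp1 mem_last.
  move=> w; rewrite inE => /orP[/eqP ->//|/Zp2]; rewrite inE => /orP[/eqP ->//|wp2].
  by rewrite -cat_cons mem_cat wp2 orbT.
Qed.

End Walks.

(** * Refining a covering walk to the next level *)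

Section Refinement.
Local Open Scope nat_scope.

(** The successor in the size bound accounts for the starting vertex; thus every position in [W] is
    at most [n * n]. *)
Definition covering_walk (n : nat) (e : rel nat) (W : seq nat) :=
  [/\ sorted e W, all (gtn n) W, {subset iota 0 n <= W} & size W <= (n * n).+1].

Variables (n' : nat) (e e' : rel nat) (c : rel nat).
Hypothesis e'_refl : forall v w, c v w -> v < n' /\ e' v v.
Hypothesis c_connected : forall w, walk_connected (c^~ w) e'.
Hypothesis c_step : forall w w', e w w' -> exists2 u, c u w & c u w'.

(** Here [c v w] is to be read as: the fine set [v] meets the coarse set [w]. A pair is a position
    in the coarse walk with a fine vertex; the monotone first component later becomes the parent
    map. *)
Let step (a b : nat * nat) := e' a.2 b.2 && (a.1 <= b.1).

Lemma path_step k u p : path step (k, u) [seq (k, v) | v <- p] = path e' u p.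
Proof. by elim: p u => //= v p IHp u; rewrite IHp /step /= leqnn andbT. Qed.

(** Induction on [j]: walk among the fine neighbours of the [j]-th coarse set to some [u] that also
    meets the next one, repeat [u] with its label raised to [j.+1] (hence the need for [e' u u]),
    then visit all fine neighbours of the next coarse set. *)
Lemma expand_walk (W : seq nat) : sorted e W -> (exists v, c v (nth 0 W 0)) ->
  forall j, j < size W -> exists x p, [/\ path step x p,
    all (fun a => (a.1 <= j) && c a.2 (nth 0 W a.1)) (x :: p),
    (last x p).1 = j &
    forall i v, i <= j -> c v (nth 0 W i) -> v \in map snd (x :: p)].
Proof.
move=> sW [v0 cv0].
pose Z w := [seq v <- iota 0 n' | c v w].
have ZP w : all (c^~ w) (Z w) by exact: filter_all.
have inZ w v : c v w -> v \in Z w.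
  by move=> cvw; rewrite mem_filter cvw mem_iota; have [] := e'_refl cvw.
elim=> [|j IHj] jW.
  have [p [pathp allp lastp Zp]] := visiting_walk (@c_connected _) (ZP _) cv0 cv0.
  exists (0, v0), [seq (0, v) | v <- p]; split.
  - by rewrite path_step.
  - by rewrite /= cv0 /= all_map; apply: sub_all allp.
  - by rewrite last_map.
  - move=> i v; rewrite leqn0 => /eqP -> cv.
    by rewrite /= -map_comp map_id_in //; apply: Zp; exact: inZ.
have [x [p [pathp allp lastp visp]]] := IHj (ltnW jW).
set l := last x p; have cl : c l.2 (nth 0 W j).
  by have /allP/(_ _ (mem_last x p)) := allp; rewrite lastp => /andP[].
have [u cuj cuj1] := c_step ((sortedP 0 sW) _ jW).
have [p1 [pathp1 allp1 lastp1]] := c_connected cl cuj.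
have [p2 [pathp2 allp2 lastp2 Zp2]] := visiting_walk (@c_connected _) (ZP _) cuj1 cuj1.
have lE : l = (j, l.2) by rewrite -lastp -surjective_pairing.
have last1 : last l [seq (j, v) | v <- p1] = (j, u).
  by rewrite lE last_map lastp1.
exists x, (p ++ [seq (j, v) | v <- p1] ++ [seq (j.+1, v) | v <- u :: p2]); split.
- rewrite !cat_path pathp /= -/l last1 path_step pathp2 lE path_step pathp1.
  by rewrite /step /= leqnSn (e'_refl cuj).2.
- rewrite -cat_cons !all_cat; apply/and3P; split.
  + by apply: sub_all allp => a /andP[/leqW -> ->].
  + by rewrite all_map; apply: sub_all allp1 => v /= ->; rewrite leqnSn.
  + by rewrite all_map /= leqnn cuj1; apply: sub_all allp2 => v /= ->; rewrite leqnn.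
- by rewrite !last_cat /= last_map.
- move=> i v; rewrite leq_eqVlt => /orP[/eqP -> cv|]; last first.
    by rewrite ltnS -cat_cons map_cat mem_cat => ij /(visp _ _ ij) ->.
  rewrite -cat_cons !map_cat !mem_cat -[X in [|| _, _ | _ \in X]]map_comp map_id_in //.
  by rewrite Zp2 ?orbT //; exact: inZ.
Qed.

(** The expanded walk is thinned and [P] reads off the labels. Thinning keeps a subsequence of a
    walk with sorted labels, so [P] is monotone. *)
Lemma refine_walk n (W : seq nat) : 0 < n -> covering_walk n e W ->
  (forall w, w < n -> exists v, c v w) ->
  (forall v, v < n' -> exists2 w, w < n & c v w) ->
  exists W' P, [/\ covering_walk n' e' W',
    forall i, i < size W' -> P i < size W /\ c (nth 0 W' i) (nth 0 W (P i)) &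
    forall i j, i <= j -> j < size W' -> P i <= P j].
Proof.
move=> n0 [sW aW cW _] c_child c_parent.
have W0 : 0 < size W by have := cW 0; rewrite mem_iota n0 => /(_ isT); case: (W).
have nthW i : i < size W -> nth 0 W i < n by move=> iW; have /allP/(_ _ (mem_nth 0 iW)) := aW.
have [|x [p [pathp allp _ visp]]] := @expand_walk W sW (c_child _ (nthW 0 W0)) (size W).-1.
  by rewrite prednK.
have inW a : a \in x :: p -> a.1 < size W /\ c a.2 (nth 0 W a.1).
  by move/(allP allp) => /andP[aj ca]; split => //; rewrite -(prednK W0).
have keys_lt : {subset map snd (x :: p) <= iota 0 n'}.
  by move=> v /mapP[a /inW[_ ca] ->]; rewrite mem_iota; have [] := e'_refl ca.
have keys_all : {subset iota 0 n' <= map snd (x :: p)}.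
  move=> v; rewrite mem_iota => vn; have [w wn cvw] := c_parent v vn.
  have wW : w \in W by apply: cW; rewrite mem_iota.
  apply: (visp (index w W)); last by rewrite nth_index.
  by rewrite -ltnS prednK // index_mem.
have path_key : path (relpre snd e') x p by apply: sub_path pathp => a b /andP[].
have sorted_pos : sorted (relpre fst leq) (x :: p).
  by apply: sub_path pathp => a b /andP[].
(* The key of [x] is left out of the targets because [thin_walk] wants them to occur after the
   start; it is visited by [x] itself. *)
have [|q [qp pathq visq sq]] := @thin_walk _ _ _ _ _ [seq v <- iota 0 n' | v != x.2] _ _ path_key keys_lt.
  move=> v; rewrite mem_filter => /andP[vx /keys_all].
  by rewrite /= inE (negPf vx).
have xqp : subseq (x :: q) (x :: p) by rewrite /= eqxx.
exists (map snd (x :: q)), (fun i => (nth x (x :: q) i).1); split.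
- split.
  + by rewrite sorted_map.
  + by apply/allP => v /mapP[a /(mem_subseq xqp)/inW[_ ca] ->]; have [] := e'_refl ca.
  + move=> v vn; have [->|vx] := eqVneq v x.2; first by rewrite /= mem_head.
    by apply: visq; rewrite mem_filter vx.
  + rewrite size_map /= ltnS; apply: leq_trans sq _; rewrite size_iota leq_mul2r.
    by rewrite size_filter (leq_trans (count_size _ _)) ?size_iota ?orbT.
- move=> i; rewrite size_map => iq.
  by rewrite (nth_map x) //; apply/inW/(mem_subseq xqp)/mem_nth.
- move=> i j ij; rewrite size_map => jq.
  have sq' : sorted (relpre fst leq) (x :: q).
    apply: subseq_sorted xqp sorted_pos => a b d; exact: leq_trans.
  apply: (sorted_leq_nth _ _ x sq') => //.
  + by move=> a b d; exact: leq_trans.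
  + by move=> a; exact: leqnn.
  + by rewrite inE (leq_ltn_trans ij).
Qed.
End Refinement.

(** * Walks through closed connected covers *)

Definition intersecting (X : Type) (A B : set X) : bool := `[< A `&` B !=set0 >].

(** Let [U] and [V] be the unions of the sets reachable and not reachable from [i]. Both are finite
    unions of closed sets, they are disjoint and they cover [B]; so [U] traces a nonempty clopen
    subset on [B], which is all of [B]. *)
Lemma connected_cover_walk (X : topologicalType) (B : set X) (n : nat)
    (A : nat -> set X) :
  connected B -> (forall i, (i < n)%N -> closed (A i)) ->
  (forall x, B x -> exists2 i, (i < n)%N & A i x) ->
  walk_connected (fun i => (i < n)%N && intersecting (A i) B)
                 (fun i j => intersecting (A i) (A j)).
Proof.
move=> conB clA covB; pose P i := (i < n)%N && intersecting (A i) B.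
pose e i j := intersecting (A i) (A j); change (walk_connected P e) => i j Pi Pj.
pose D := [set k | exists p, [/\ path e i p, all P p & last i p = k]].
have DP k : D k -> P k.
  case=> p [_ allp <-]; have := mem_last i p.
  by rewrite inE => /orP[/eqP -> //|/(allP allp)].
have finP : finite_set [set k | P k].
  by apply: (@sub_finite_set _ _ `I_n) => // k /= /andP[].
pose U := \bigcup_(k in D) A k.
pose V := \bigcup_(k in [set k | P k /\ ~ D k]) A k.
have clU : closed U.
  apply: closed_bigcup; first by apply: sub_finite_set finP => k /DP.
  by move=> k /DP /andP[kn _]; exact: clA.
have clV : closed V.
  apply: closed_bigcup; first by apply: sub_finite_set finP => k [].
  by move=> k [/andP[kn _] _]; exact: clA.
have Dadj k l x : D k -> P l -> A k x -> A l x -> D l.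
  move=> [p [pathp allp lastp]] Pl Akx Alx; exists (rcons p l); split.
  - by rewrite rcons_path pathp lastp; apply/asboolP; exists x.
  - by rewrite all_rcons Pl.
  - by rewrite last_rcons.
have BU : B `&` U = B.
  apply: conB.
  - have /andP[_ /asboolP[x [Aix Bx]]] := Pi.
    by exists x; split=> //; exists i => //; exists [::].
  - exists (~` V); first exact: closed_openC.
    apply/seteqP; split => x [Bx].
      move=> [k Dk Akx]; split=> // -[l [Pl nDl] Alx].
      by apply: nDl; exact: (Dadj k l x).
    move=> nVx; split=> //; have [k kn Akx] := covB x Bx.
    have Pk : P k by rewrite /P kn; apply/asboolP; exists x.
    by exists k => //; apply: contrapT => nDk; apply: nVx; exists k.
  - by exists U.
have /andP[_ /asboolP[x [Ajx Bx]]] := Pj.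
move: (Bx); rewrite -BU => -[_ [k Dk Akx]].
exact: (Dadj k j x).
Qed.

Section Tower.
Variables (X : topologicalType) (n : nat -> nat) (A : nat -> nat -> set X).
Hypothesis A_closed : forall m v, closed (A m v).
Hypothesis A_connected : forall m v, connected (A m v).
Hypothesis A_neq0 : forall m v, A m v !=set0.
Hypothesis A_cover : forall m x, exists2 v, (v < n m)%N & A m v x.
Hypothesis n0 : n 0 = 1%N.

Let adj m : rel nat := fun v w => intersecting (A m v) (A m w).

Lemma nested_walks : exists (W : nat -> seq nat) (P : nat -> nat -> nat),
  forall m, [/\ covering_walk (n m) (adj m) (W m),
    forall i, (i < size (W m.+1))%N -> (P m i < size (W m))%N /\
      A m.+1 (nth 0%N (W m.+1) i) `&` A m (nth 0%N (W m) (P m i)) !=set0 &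
    forall i j, (i <= j)%N -> (j < size (W m.+1))%N -> (P m i <= P m j)%N].
Proof.
pose good m W := covering_walk (n m) (adj m) W.
pose linked m W W' (P : nat -> nat) :=
  (forall i, (i < size W')%N -> (P i < size W)%N /\
      A m.+1 (nth 0%N W' i) `&` A m (nth 0%N W (P i)) !=set0) /\
  (forall i j, (i <= j)%N -> (j < size W')%N -> (P i <= P j)%N).
(* The refinement is made total by a dummy value on lists that are not covering walks, so that
   [choice] turns it into a function to iterate. *)
have next (a : nat * seq nat) : exists b : seq nat * (nat -> nat),
    good a.1 a.2 -> good a.1.+1 b.1 /\ linked a.1 a.2 b.1 b.2.
  case: a => m W /=; have [gW|?] := pselect (good m W); last by exists ([::], id).
  (* [A m.+1] is defined at every index, so the relation itself must restrict [v] to the actual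
     cover. *)
  pose c : rel nat := fun v w => (v < n m.+1)%N && intersecting (A m.+1 v) (A m w).
  have n_gt0 : (0 < n m)%N.
    have [x _] := A_neq0 0 0; have [v vn _] := A_cover m x.
    exact: leq_ltn_trans vn.
  have [|||||W' [P [gW' lW' mW']]] := @refine_walk (n m.+1) (adj m) (adj m.+1) c _ _ _ _ _ n_gt0 gW.
  - move=> v w /andP[vn _]; split=> //; apply/asboolP.
    by have [x Ax] := A_neq0 m.+1 v; exists x.
  - move=> w; exact: (connected_cover_walk (@A_connected m w)
      (fun i _ => @A_closed m.+1 i) (fun x _ => A_cover m.+1 x)).
  - move=> w w' /asboolP[x [Awx Aw'x]]; have [u un Aux] := A_cover m.+1 x.
    by exists u; rewrite /c un; apply/asboolP; exists x.
  - move=> w _; have [x Awx] := A_neq0 m w; have [u un Aux] := A_cover m.+1 x.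
    by exists u; rewrite /c un; apply/asboolP; exists x.
  - move=> v vn; have [x Avx] := A_neq0 m.+1 v; have [w wn Awx] := A_cover m x.
    by exists w => //; rewrite /c vn; apply/asboolP; exists x.
  exists (W', P) => _; split=> //; split=> // i iW'.
  by have [PW /andP[_ /asboolP]] := lW' i iW'.
have [f fP] := choice next.
pose W := fix W m := if m is m'.+1 then (f (m', W m')).1 else [:: 0%N].
have gW m : good m (W m).
  elim: m => [|m IHm]; last by have [] := fP (m, W m) IHm.
  by rewrite /good /covering_walk n0; split.
exists W, (fun m => (f (m, W m)).2) => m; split; first exact: gW.
all: by have [_ []] := fP (m, W m) (gW m).
Qed.
End Tower.

(** * Ultrafilter limits and small dyadic numbers *)

Lemma ultrafilter_compact_cvg (I : Type) (X : topologicalType) (K : set X)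
    (f : I -> X) (U : set_system I) : UltraFilter U -> compact K ->
  (\forall i \near U, K (f i)) -> exists2 p, K p & f @ U --> p.
Proof.
move=> UU cK UK; have [p [Kp clp]] := cK (f @ U) _ UK.
(* A cluster point of an ultrafilter is a limit: otherwise the complement of some neighbourhood [V]
   would belong to the image filter and yet meet [V]. *)
exists p => // V Vp; have [//|UnV] := in_ultra_setVsetC (f @^-1` V) UU.
have [y []] := clp (~` V) V UnV Vp.
by move=> nVy Vy; case: nVy.
Qed.

Lemma dyadic_small (R : realType) (e : R) : 0 < e ->
  \forall N \near \oo, 2 ^- N < e.
Proof.
move=> e0; have := near_infty_natSinv_expn_lt (PosNum e0).
by apply: filterS => N; rewrite div1r.
Qed.

(** * Starting times and the step functions they define *)

Section NestedWalks.
Variables (R : realType) (X : metricType R) (n : nat -> nat)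
  (A : nat -> nat -> set X) (W : nat -> seq nat) (P : nat -> nat -> nat)
  (a : nat -> R) (s : R).
Hypothesis A_diam : forall m v x y, A m v x -> A m v y -> mdist x y <= 2 ^- m.
Hypothesis A_neq0 : forall m v, A m v !=set0.
Hypothesis A_cover : forall m x, exists2 v, (v < n m)%N & A m v x.
Hypothesis W_walk : forall m,
  covering_walk (n m) (fun v w => intersecting (A m v) (A m w)) (W m).
Hypothesis P_meets : forall m i, (i < size (W m.+1))%N -> (P m i < size (W m))%N /\
  A m.+1 (nth 0%N (W m.+1) i) `&` A m (nth 0%N (W m) (P m i)) !=set0.
Hypothesis P_homo : forall m i j,
  (i <= j)%N -> (j < size (W m.+1))%N -> (P m i <= P m j)%N.
Hypothesis a_gt0 : forall m, (0 < m)%N -> 0 < a m.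
Hypothesis s_ge : forall N, \sum_(1 <= k < N.+1) (n k * n k)%:R * a k <= s.

Local Notation B m i := (A m (nth 0%N (W m) i)).

(* [a m] separates the starting times of consecutive members of [W m]. *)
Fixpoint start m i : R :=
  if m is m'.+1 then start m' (P m' i) + a m * i%:R else 0.

Lemma size_walk_gt0 m : (0 < size (W m))%N.
Proof.
have [x _] := A_neq0 m 0; have [v vn _] := A_cover m x.
have [_ _ + _] := W_walk m; move/(_ v); rewrite mem_iota vn => /(_ isT).
by case: (W m).
Qed.

Lemma start_homo m i j : (i <= j)%N -> (j < size (W m))%N -> start m i <= start m j.
Proof.
elim: m i j => [|m IHm] i j ij jW; first by rewrite lexx.
rewrite [start _ _]/= lerD //.
  by apply: IHm; [exact: P_homo | have [] := P_meets jW].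
by rewrite ler_wpM2l ?ler_nat // ltW ?a_gt0.
Qed.

Lemma start_gap m i j : (0 < m)%N -> (i < j)%N -> (j < size (W m))%N ->
  start m i + a m <= start m j.
Proof.
case: m => // m _ ij jW /=; rewrite -addrA lerD //.
  by apply: start_homo; [exact/P_homo/jW/ltnW | have [] := P_meets jW].
by rewrite -[X in _ + X]mulr1 -mulrDr natr1 ler_wpM2l ?ler_nat // ltW ?a_gt0.
Qed.

Lemma start_bounds m i : (i < size (W m))%N -> 0 <= start m i <= s.
Proof.
move=> iW; suff /andP[-> le] : 0 <= start m i <= \sum_(1 <= k < m.+1) (n k * n k)%:R * a k.
  exact: le_trans le (s_ge m).
elim: m i iW => [|m IHm] i iW; first by rewrite big_geq //= lexx.
have [PW _] := P_meets iW; have /andP[ge le] := IHm _ PW.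
have a0 := ltW (@a_gt0 m.+1 isT).
rewrite big_nat_recr //= addr_ge0 ?mulr_ge0 //= lerD // mulrC ler_wpM2r // ler_nat.
by have [_ _ _ Wn] := W_walk m.+1; rewrite -ltnS (leq_trans iW).
Qed.

(** For [d = 0] the gap between starting times forces [i = j]. Passing from level [l] to parents at
    level [l - 1] does not increase the time difference and costs [2 * 2 ^- l] in distance; the
    bound is the closed form of [2 ^- k] plus these costs for [k < l <= k + d]. *)
Lemma start_close k d i j x y : (0 < k)%N -> (i <= j)%N -> (j < size (W (k + d)))%N ->
  start (k + d) j - start (k + d) i < a k -> B (k + d) i x -> B (k + d) j y ->
  mdist x y <= 3 * 2 ^- k - 2 * 2 ^- (k + d).
Proof.
move=> k0; elim: d i j x y => [|d IHd] i j x y.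
  rewrite addn0 leq_eqVlt => /orP[/eqP -> _ _ Bx By|ij jW].
    by apply: le_trans (A_diam Bx By) _; lra.
  by have := start_gap k0 ij jW; lra.
rewrite addnS => ij jW lt Bx By.
have [PiW [x' [Bx' Cx']]] := P_meets (leq_ltn_trans ij jW).
have [PjW [y' [By' Cy']]] := P_meets jW.
have d1 := A_diam Bx Bx'; have d2 := A_diam By' By.
have := IHd (P (k + d) i) (P (k + d) j) x' y' (P_homo ij jW) PjW _ Cx' Cy'.
have t1 := metric_triangle x x' y; have t2 := metric_triangle x' y' y.
have e2 : 2 ^- (k + d) = 2 * 2 ^- (k + d).+1 :> R.
  by rewrite exprS invfM mulrA mulfV ?mul1r // pnatr_eq0.
have ij_R : i%:R <= j%:R :> R by rewrite ler_nat.
have := ler_wpM2l (ltW (@a_gt0 (k + d).+1 isT)) ij_R.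
move: lt => /= lt aij /(_ _)/wrap[]; first by lra.
by rewrite e2; lra.
Qed.

(** The slot is the last position that has started by time [t]. The guard [0 < i] makes slot 0 the
    default before any start, so that every real [t] has a slot. *)
Lemma time_slot m t : exists i, [/\ (i < size (W m))%N, (0 < i)%N -> start m i <= t &
  forall j, (i < j)%N -> (j < size (W m))%N -> t < start m j].
Proof.
have := size_walk_gt0 m; move: (size (W m)) (@start_homo m) => L.
elim: L => // -[_ _ _|L IHL mono _]; first by exists 0%N; split=> // -[].
have [|i [iL ile ilt]] := IHL _ isT.
  by move=> i j ij jL; apply: mono => //; exact: leqW.
have [le|lt] := leP (start m L.+1) t.
  by exists L.+1; split=> // j Lj; rewrite ltnS leqNgt Lj.
exists i; split=> //; first exact: leqW.
move=> j ij; rewrite ltnS leq_eqVlt => /orP[/eqP -> //|]; exact: ilt.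
Qed.

Lemma discrete_map N : (0 < N)%N -> exists f : R -> X,
  (forall k t t', (0 < k <= N)%N -> `|t - t'| < a k ->
     mdist (f t) (f t') <= 3 * 2 ^- k + 2 * 2 ^- N) /\
  (forall x, exists2 t, 0 <= t <= s & mdist (f t) x <= 2 ^- N).
Proof.
move=> N0; have [g gA] := choice (A_neq0 N).
have [idx idxP] := choice (time_slot N).
have e0 : 0 < 2 ^- N :> R by rewrite invr_gt0 exprn_gt0.
exists (fun t => g (nth 0%N (W N) (idx t))); split.
  move=> k t t' /andP[k0 kN]; wlog tt' : t t' / t <= t'.
    move=> H; have [/H//|/ltW/H] := leP t t'; rewrite distrC metric_sym; exact.
  rewrite ler0_norm ?subr_le0 // opprB => lt.
  have [iW it tlt] := idxP t; have [jW jt t'lt] := idxP t'.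
  move: (idx t) (idx t') iW it tlt jW jt t'lt => i j iW it tlt jW jt t'lt.
  have [ij|ji|<-] := ltngtP i j; last first.
  - by rewrite mdistxx addr_ge0 // mulr_ge0 // ltW // invr_gt0 exprn_gt0.
  - by have := it (leq_ltn_trans (leq0n _) ji); have := t'lt _ ji iW; lra.
  have iW1 := leq_ltn_trans ij jW.
  (* Member [i] may have started long before [t], but member [i.+1] starts after [t] and [j] has
     started by [t'], so these two starts are less than [a k] apart. Consecutive members intersect,
     which bridges [i] and [i.+1]. *)
  have := @start_close k (N - k) i.+1 j (g (nth 0%N (W N) i.+1)) (g (nth 0%N (W N) j)) k0 ij.
  rewrite subnKC // => /(_ jW) => /(_ _ (gA _) (gA _))/wrap[].
    by have := tlt _ (ltnSn i) iW1; have := jt (leq_ltn_trans (leq0n _) ij); lra.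
  have [sW _ _ _] := W_walk N.
  have /asboolP[z [z1 z2]] := (sortedP 0%N sW) _ iW1.
  have := A_diam (gA _) z1; have := A_diam z2 (gA _).
  set x := g (nth 0%N (W N) i); set x' := g (nth 0%N (W N) i.+1); set y := g _.
  have := metric_triangle x z x'; have := metric_triangle x x' y.
  lra.
move=> x; have [v vn Avx] := A_cover N x.
have [_ _ + _] := W_walk N; move/(_ v); rewrite mem_iota vn => /(_ isT) vW.
have iW : (index v (W N) < size (W N))%N by rewrite index_mem.
exists (start N (index v (W N))); first exact: start_bounds.
have [jW jle jlt] := idxP (start N (index v (W N))).
move: (idx _) jW jle jlt => j jW jle jlt.
(* At its own starting time a member occupies the slot, since starting times strictly increase. *)
have -> : j = index v (W N).
  apply/eqP; rewrite eqn_leq; apply/andP; split; rewrite leqNgt; apply/negP => lt.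
    have := start_gap N0 lt jW; have := a_gt0 N0.
    by have := jle (leq_ltn_trans (leq0n _) lt); lra.
  by have := jlt _ lt iW; rewrite ltxx.
by apply: A_diam (gA _) _; rewrite nth_index.
Qed.

End NestedWalks.

(** * The limit of the step functions *)

Lemma limit_surjection (R : realType) (X : metricType R) (a : nat -> R) (s : R) :
  compact [set: X] -> (forall k, (0 < k)%N -> 0 < a k) ->
  (forall N, exists f : R -> X,
    (forall k t t', (0 < k <= N.+1)%N -> `|t - t'| < a k ->
       mdist (f t) (f t') <= 3 * 2 ^- k + 2 * 2 ^- N.+1) /\
    (forall x, exists2 t, 0 <= t <= s & mdist (f t) x <= 2 ^- N.+1)) ->
  exists f : R -> X,
    (forall k t t', (0 < k)%N -> `|t - t'| < a k ->
       mdist (f t) (f t') <= 3 * 2 ^- k) /\ f @` `[0, s]%classic = [set: X].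
Proof.
move=> cX a_gt0 /choice[F FP].
(* A single ultrafilter finer than [\oo] provides limits at all times simultaneously, and also of
   the approximate preimages [tt] of a point. *)
have [U [UU sU]] := @ultraFilterLemma _ (\oo : set_system nat) _.
have limF t : exists y : X, F ^~ t @ U --> y.
  by have [|y _] := @ultrafilter_compact_cvg _ _ _ (F ^~ t) U UU cX; [exact: filterE|exists y].
have [f fP] := choice limF.
have small e : 0 < e -> \forall N \near U, 2 ^- N.+1 < e :> R.
  move=> e0; apply: sU; near=> N; apply: (@lt_trans _ _ (2 ^- N)).
    by rewrite ltf_pV2 ?posrE ?exprn_gt0 // ltr_eXn2l ?ltr1n.
  by near: N; exact: dyadic_small.
have large k : \forall N \near U, (k <= N.+1)%N.
  by apply: sU; near=> N; apply: leqW; near: N; exact: nbhs_infty_ge.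
have f_close t e : 0 < e -> \forall N \near U, mdist (f t) (F N t) < e.
  move=> e0; exact: (metricType_numDomainType.cvgr_dist_lt (fP t) e0).
exists f; split.
  move=> k t t' k0 lt; apply/ler_addgt0Pl => e e0.
  have e4 : 0 < e / 4 by lra.
  have [N [[[N1 N2] N3] N4]] := filter_ex (filterI (filterI (filterI
    (f_close t _ e4) (f_close t' _ e4)) (small _ e4)) (large k)).
  have := (FP N).1 k t t'; rewrite k0 N4 => /(_ isT lt).
  have := metric_triangle (f t) (F N t) (f t').
  have := metric_triangle (F N t) (F N t') (f t').
  rewrite (metric_sym (F N t') (f t')); move: N1 N2 N3.
  lra.
apply/seteqP; split=> // x _.
have /choice[tt ttP] : forall N, exists t : R,
    0 <= t <= s /\ mdist (F N t) x <= 2 ^- N.+1.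
  by move=> N; have [t ? ?] := (FP N).2 x; exists t.
have [|t ts tt_t] := @ultrafilter_compact_cvg _ _ _ tt U UU (@segment_compact R 0 s).
  by apply: filterE => N; rewrite /= in_itv /= (ttP N).1.
exists t => //; apply: mdist_positivity; apply/eqP; rewrite eq_le mdist_ge0 andbT.
apply/ler_addgt0Pl => e e0; rewrite addr0.
(* The errors are one eighth for [f t], three for [3 * 2 ^- k], two for [2 * 2 ^- N.+1] and one for
   the approximate preimage, seven in all. *)
have e8 : 0 < e / 8 by lra.
have [k [klt k0]] := filter_ex (filterI (dyadic_small e8) (nbhs_infty_gt 0)).
have t_close : \forall N \near U, `|t - tt N| < a k.
  by move/cvgrPdist_lt: tt_t; apply; exact: a_gt0.
have [N [[[N1 N2] N3] N4]] := filter_ex (filterI (filterI (filterI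
    (f_close t _ e8) t_close) (small _ e8)) (large k)).
have := (FP N).1 k t (tt N); rewrite k0 N4 => /(_ isT N2).
have [_] := ttP N.
have := metric_triangle (f t) (F N t) x.
have := metric_triangle (F N t) (F N (tt N)) x.
move: N1 N3 klt => /=.
lra.
Unshelve. all: by end_near. Qed.

(** * Closed connected covers of minimal cardinality *)

Lemma closure_mdist_le (R : realType) (X : metricType R) (B : set X) (e : R) :
  (forall x y, B x -> B y -> mdist x y <= e) ->
  forall x y, closure B x -> closure B y -> mdist x y <= e.
Proof.
move=> Be x y clx cly; apply/ler_addgt0Pl => d d0.
have d2 : 0 < d / 2 by lra.
have [x' [Bx' xx']] := clx _ (nbhsx_ballx x _ d2).
have [y' [By' yy']] := cly _ (nbhsx_ballx y _ d2).
rewrite !ballEmdist /= in xx' yy'.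
have := metric_triangle x x' y; have := metric_triangle x' y' y.
by rewrite (metric_sym y' y); have := Be _ _ Bx' By'; lra.
Qed.

Lemma diam_le (R : realType) (X : metricType R) (B : set X) (e : R) :
  (diam B <= e%:E)%E -> forall x y, B x -> B y -> mdist x y <= e.
Proof.
move=> Be x y Bx By; rewrite -lee_fin; apply: le_trans Be.
by apply: ereal_sup_ubound; left; exists x => //; exists y.
Qed.

Lemma Snum_ge0 (R : realType) (X : metricType R) (e : R) : (0 <= Snum X e)%E.
Proof. by apply: le_ereal_inf_tmp => _ [k _ <-]; rewrite lee_fin. Qed.

Lemma Snum_attained (R : realType) (X : metricType R) (e : R) :
  (Snum X e < +oo)%E -> exists2 k : nat, Snum X e = (k%:R)%:E &
    exists2 C : set (set X), conn_cover e C & (C #= `I_k)%card.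
Proof.
move=> fin; pose Q : set nat := [set k | exists2 C : set (set X), conn_cover e C & (C #= `I_k)%card].
have exQ : exists k, `[< Q k >].
  apply: contrapT => nQ; move: fin; rewrite /Snum -/Q.
  rewrite (_ : Q = set0) ?image_set0 ?ereal_inf0 ?ltxx //.
  by apply/seteqP; split=> // k Qk; apply: nQ; exists k; apply/asboolP.
case: (ex_minnP exQ) => k /asboolP Qk kmin; exists k => //.
apply/eqP; rewrite eq_le; apply/andP; split.
  by apply: ereal_inf_lbound; exists k.
apply: le_ereal_inf_tmp => _ [j Qj <-]; rewrite lee_fin ler_nat.
by apply: kmin; apply/asboolP.
Qed.

Lemma closed_connected_cover (R : realType) (X : metricType R) (e : R) :
  [set: X] !=set0 -> 0 < e -> (Snum X e < +oo)%E ->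
  exists (k : nat) (A : nat -> set X), [/\ Snum X e = (k%:R)%:E,
    forall v, [/\ closed (A v), connected (A v), A v !=set0 &
      forall x y, A v x -> A v y -> mdist x y <= e] &
    forall x, exists2 v, (v < k)%N & A v x].
Proof.
move=> [x0 _] e0 /Snum_attained[k Sk [C [Cconn Ccov] /card_esym/card_set_bijP[h hbij]]].
have [h_fun _ h_surj] := hbij.
have hC v : (v < k)%N -> C (h v) by exact: h_fun.
(* Empty members and indices from [k] on are replaced by a singleton, so that every index names a
   nonempty set. Closures then retain connectedness and the distance bound. *)
pose D v := if (v < k)%N && `[< h v !=set0 >] then h v else [set x0].
have DP v : [/\ connected (D v), D v !=set0 & forall x y, D v x -> D v y -> mdist x y <= e].
  rewrite /D; case: ifPn => [/andP[/hC/Cconn[ch dh] /asboolP h0]|_].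
    by split=> //; exact: diam_le.
  split; [exact: connected1 | by exists x0 |].
  by move=> x y /= -> ->; rewrite mdistxx ltW.
exists k, (fun v => closure (D v)); split=> // [v|x].
  have [Dc [y Dy] Dd] := DP v; split.
  - exact: closed_closure.
  - exact: connected_closure.
  - by exists y; exact: subset_closure.
  - exact: closure_mdist_le.
have [B CB Bx] : (\bigcup_(B in C) B) x by rewrite Ccov.
have [v vk hv] := h_surj B CB.
exists v => //; apply: subset_closure; rewrite /D vk hv.
by rewrite asboolT //; exists x.
Qed.

Lemma nested_covers (R : realType) (X : metricType R) :
  [set: X] !=set0 -> connected [set: X] -> (diam [set: X] <= 1)%E ->
  (forall m, (0 < m)%N -> (Snum X (2 ^- m) < +oo)%E) ->
  exists (n : nat -> nat) (A : nat -> nat -> set X),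
    [/\ n 0 = 1%N, forall m, (0 < m)%N -> Snum X (2 ^- m) = ((n m)%:R)%:E,
    forall m v, [/\ closed (A m v), connected (A m v), A m v !=set0 &
      forall x y, A m v x -> A m v y -> mdist x y <= 2 ^- m] &
    forall m x, exists2 v, (v < n m)%N & A m v x].
Proof.
move=> X0 Xconn Xdiam Sfin.
have level m : exists nA : nat * (nat -> set X), [/\ m = 0%N -> nA.1 = 1%N,
    (0 < m)%N -> Snum X (2 ^- m) = ((nA.1)%:R)%:E,
    forall v, [/\ closed (nA.2 v), connected (nA.2 v), nA.2 v !=set0 &
      forall x y, nA.2 v x -> nA.2 v y -> mdist x y <= 2 ^- m] &
    forall x, exists2 v, (v < nA.1)%N & nA.2 v x].
  case: m => [|m].
    (* The whole space serves as the single set of level 0, its diameter being at most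
       [1 = 2 ^- 0]. *)
    exists (1%N, fun=> setT); split=> // [v|x]; last by exists 0%N.
    split; [exact: closedT | exact: Xconn | exact: X0 |].
    by move=> x y _ _; rewrite expr0 invr1; exact: diam_le Xdiam _ _ _ _.
  have e0 : 0 < 2 ^- m.+1 :> R by rewrite invr_gt0 exprn_gt0.
  have [k [A [Sk AP Acov]]] := closed_connected_cover X0 e0 (Sfin m.+1 isT).
  by exists (k, A).
have [nA nAP] := choice level.
exists (fun m => (nA m).1), (fun m => (nA m).2).
split=> [|m|m|m]; first by have [/(_ erefl)] := nAP 0%N.
all: by have [_ nS AP Acov] := nAP m.
Qed.

Lemma Snum_gt0 (R : realType) (X : metricType R) (e : R) :
  [set: X] !=set0 -> (0 < Snum X e)%E.
Proof.
move=> [x _]; rewrite lt_neqAle Snum_ge0 andbT; apply/eqP => S0.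
have [|k] := @Snum_attained _ X e; first by rewrite -S0.
rewrite -S0 => -[/eqP]; rewrite eq_sym pnatr_eq0 => /eqP -> [C [_ Ccov]].
rewrite II0 card_eq0 => /eqP C0.
have : (\bigcup_(B in C) B) x by rewrite Ccov.
by rewrite C0 bigcup_set0.
Qed.

(** * The series bound and the assembly of the theorem *)

Lemma double_series_ge (R : realType) (S a : nat -> \bar R) (N : nat) :
  (forall n, 0 <= S n)%E -> (forall n, 0 <= a n)%E ->
  (\sum_(1 <= n < N) S n * (S n * a n) <=
   \sum_(1 <= n <oo) S n * \sum_(n <= m <oo) S m * a m)%E.
Proof.
move=> S0 a0.
have inner n : (S n * a n <= \sum_(n <= m <oo) S m * a m)%E.
  apply: le_trans (nneseries_lim_ge n.+1 _) => [|m _ _]; last exact: mule_ge0.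
  by rewrite big_nat1.
apply: (@le_trans _ _ (\sum_(1 <= n < N) S n * \sum_(n <= m <oo) S m * a m)%E).
  by apply: lee_sum => n _; apply: lee_wpmul2l.
apply: nneseries_lim_ge => n _ _; apply: mule_ge0 => //.
by apply: nneseries_ge0 => m _ _; exact: mule_ge0.
Qed.

Theorem theorem1p1 (R : realType) (X : metricType R) (Omega : R -> R)
    (X_neq0 : [set: X] !=set0) (X_compact : compact [set: X])
    (X_connected : connected [set: X]) (X_diam : (diam [set: X] <= 1)%E)
    (Omega_gt0 : forall t : R, 0 < t -> 0 < Omega t)
    (Omega_incr : forall t u : R, 0 < t -> t < u -> Omega t < Omega u)
    (Omega_range : `]0, 1]%classic `<=` Omega @` `]0, +oo[%classic) :
  let Omega_inv : R -> R := 'pinv_(fun=> 0) (`]0, +oo[%classic : set R) Omega in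
  let s : \bar R :=
    (\sum_(1 <= n <oo) (Snum X (2 ^- n) *
       \sum_(n <= m <oo) (Snum X (2 ^- m) *
         (Omega_inv (Num.min 1 (2 ^ (6%:Z - m%:Z))))%:E)))%E in
  (s < +oo)%E ->
  exists f : R -> X,
    [/\ {within `[0, fine s]%classic, continuous f},
        f @` `[0, fine s]%classic = [set: X] &
        forall delta : R, 0 < delta ->
          (modulus (X := R^o) `[0%R, fine s]%classic f delta <= (Omega delta)%:E)%E].
Proof.
move=> Omega_inv s s_fin.
pose y m : R := Num.min 1 (2 ^ (6%:Z - m%:Z)); pose a m := Omega_inv (y m).
have y01 m : y m \in `]0, 1]%classic.
  by rewrite inE /= in_itv /= lt_min ltr01 exprz_gt0 //= ge_min lexx.
have Omega_a m : Omega (a m) = y m.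
  by rewrite /a pinvK // inE; apply: Omega_range; rewrite -inE.
have a_gt0 m : 0 < a m.
  have : `]0, +oo[%classic (a m).
    apply: (surjpinv_image_sub Omega_range).
    by exists (y m) => //; rewrite -inE.
  by rewrite /= in_itv /= andbT.
have S0 m : (0 <= Snum X (2 ^- m : R))%E by exact: Snum_ge0.
have s_ge N : (\sum_(1 <= n < N.+1) Snum X (2 ^- n : R) * (Snum X (2 ^- n : R) * (a n)%:E) <= s)%E.
  by apply: double_series_ge => // n; rewrite lee_fin ltW.
(* An infinite covering number would make the [m]-th diagonal term, and hence [s], infinite. *)
have S_fin m : (0 < m)%N -> (Snum X (2 ^- m) < +oo)%E.
  move=> m0; rewrite ltey; apply/eqP => Sy.
  have := le_lt_trans (s_ge m) s_fin; rewrite big_nat_recr //= Sy.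
  rewrite [(+oo * (a m)%:E)%E]gt0_mulye ?lte_fin // mulyy addey ?ltxx //.
  rewrite gt_eqF // (lt_le_trans (ltNyr 0)) // sume_ge0 // => n _.
  by rewrite !mule_ge0 // lee_fin ltW.
have [n [A [n0 nS AP Acov]]] := nested_covers X_neq0 X_connected X_diam S_fin.
have s_real : s = (fine s)%:E.
  by rewrite fineK // ge0_fin_numE //; apply: le_trans (s_ge 0%N); rewrite big_geq.
have s_ge' N : \sum_(1 <= k < N.+1) (n k * n k)%:R * a k <= fine s.
  rewrite -lee_fin -s_real; apply: le_trans (s_ge N); rewrite -sumEFin.
  rewrite big_nat_cond [leRHS]big_nat_cond; apply: lee_sum => k /andP[/andP[k0 _] _].
  by rewrite nS // -!EFinM natrM mulrA.
have [W [P WP]] := nested_walks (fun m v => let: And4 h _ _ _ := AP m v in h)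
  (fun m v => let: And4 _ h _ _ := AP m v in h)
  (fun m v => let: And4 _ _ h _ := AP m v in h) Acov n0.
have [||f [f_mod f_onto]] := @limit_surjection R X a (fine s) X_compact.
- by move=> k _.
- move=> N; apply: (@discrete_map R X n A W P a (fine s)) => //.
  + by move=> m v; have [] := AP m v.
  + by move=> m v; have [] := AP m v.
  + by move=> m; have [] := WP m.
  + by move=> m; have [] := WP m.
  + by move=> m; have [] := WP m.
have Omega_homo t u : 0 < t -> 0 < u -> Omega t < Omega u -> t < u.
  move=> t0 u0; rewrite !ltNge; apply: contra; rewrite le_eqVlt => /predU1P[->//|ut].
  by rewrite ltW // Omega_incr.
exists f; split => //.
- apply: continuous_subspaceT => t.
  apply/metricType_numDomainType.cvgrPdist_lt => e e0.
  have e3 : 0 < e / 3 by lra.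
  have [k [klt k0]] := filter_ex (filterI (dyadic_small e3) (nbhs_infty_gt 0)).
  have : \forall t' \near t, `|t - t'| < a k by move: (@cvg_id _ (nbhs t)) => /cvgrPdist_lt; apply.
  apply: filterS => t' /(f_mod k _ _ k0); move: klt => /=; lra.
- move=> delta delta0; apply/ereal_supP => _ [[t [t' [_ _ tt' ->]]]|->]; last first.
    by rewrite lee_fin ltW // Omega_gt0.
  rewrite lee_fin; have [le1|lt1] := leP 1 (Omega delta).
    by apply: le_trans le1; exact: (diam_le X_diam).
  (* With the least such exponent written [j.+1], minimality gives
     [2 ^- j.+1 <= Omega delta < 2 ^- j]. *)
  have ex_j : exists j, 2 ^- j <= Omega delta.
    by have [j /ltW] := filter_ex (dyadic_small (Omega_gt0 _ delta0)); exists j.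
  case: (ex_minnP ex_j) => -[|j] jle jmin.
    by move: jle; rewrite expr0 invr1 leNgt lt1.
  (* At index [6 + j] the value [y] is [min(1, 2 ^- j)], which exceeds [Omega delta]; monotonicity
     of [Omega] then compares the arguments. *)
  have lt_a : delta < a (6 + j)%N.
    apply: Omega_homo => //; rewrite Omega_a /y lt_min lt1.
    rewrite PoszD opprD addrA subrr add0r -exprnN ltNge.
    by apply/negP => /jmin; rewrite ltnn.
  have := f_mod (6 + j)%N t t' isT.
  have -> : `|t - t'| < a (6 + j)%N by rewrite distrC; exact: le_lt_trans lt_a.
  move=> /(_ isT)/le_trans; apply; apply: le_trans jle.
  (* What remains is [3 * 2 ^- (6 + j) <= 2 ^- j.+1], that is [3 / 64 <= 1 / 2]. *)
  rewrite exprD (exprS _ j) !invfM.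
  have : 0 < 2 ^- j :> R by rewrite invr_gt0 exprn_gt0.
  lra.
Qed.
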